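(* Let $b\ge 2$, let $n_1,\ldots,n_b$ be positive integers, and let $\mathcal{S}(n_1,n_2,\ldots,n_b)$ be a starlike block graph with $\mathcal{S}(n_1,n_2,\ldots,n_b)\neq \mathcal{S}(1,1)$. If $\Delta$ is the squared distance matrix of $\mathcal{S}(n_1,n_2,\ldots,n_b)$, then $\Delta$ is an invertible matrix and $$\Delta^{-1} = - \mathcal{L} + \frac{1}{\lambda}\, \eta \eta^t,$$ where the matrix $\mathcal{L}$, the scalar $\lambda$ and the column vector $\eta$ are as defined in the context.
   Context: The starlike block graph $\mathcal{S}(n_1,\ldots,n_b)$ is the graph consisting of $b\ge 2$ blocks which are the complete graphs $K_{n_1+1},\ldots,K_{n_b+1}$ (each $n_i\ge 1$), all sharing exactly one common vertex, the central cut vertex. It has $n=1+\sum_{i=1}^b n_i$ vertices. Its vertex set is partitioned as $V_0\cup V_1\cup\cdots\cup V_b$, where $V_0$ consists of the central cut vertex and $V_i$ ($1\le i\le b$) consists of the $n_i$ vertices of the block $K_{n_i+1}$ other than the central cut vertex. For a simple connected graph $G$ with vertices $v_1,\ldots,v_n$, the squared distance matrix is $\Delta(G)=[d(v_i,v_j)^2]$, where $d$ is the shortest-path distance. All matrices and vectors are indexed by the vertices in the same order. Put (indices range over $\{1,\ldots,b\}$, empty products equal $1$) $$\alpha=\prod_{k=1}^b(3n_k+1),\quad \alpha_{\widehat{n_i}}=\prod_{k\ne i}(3n_k+1),\quad \alpha_{\widehat{n_in_j}}=\prod_{k\neq i,j}(3n_k+1)\ (i\ne j),$$ $$\beta=\sum_{k=1}^b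 n_k\,\alpha_{\widehat{n_k}},\qquad \beta_{\widehat{n_i}}=\sum_{k\ne i} n_k\,\alpha_{\widehat{n_in_k}}.$$ Let $\widehat{\mathcal{L}}=[\widehat{\mathcal{L}}_{uv}]$ be the symmetric $n\times n$ matrix with $$\widehat{\mathcal{L}}_{uv}=\begin{cases}\beta & u=v\in V_0,\\ -\alpha_{\widehat{n_i}} & u\in V_0,\ v\in V_i\ (1\le i\le b)\ \text{(or vice versa)},\\ (6\beta_{\widehat{n_i}}-\alpha_{\widehat{n_i}})+(\alpha-2\beta) & u=v\in V_i\ (1\le i\le b),\\ 6\beta_{\widehat{n_i}}-\alpha_{\widehat{n_i}} & u\ne v,\ u,v\in V_i\ (1\le i\le b),\\ 2\alpha_{\widehat{n_in_j}} & u\in V_i,\ v\in V_j,\ i\neq j,\ 1\le i,j\le b.\end{cases}$$ When $\mathcal{S}(n_1,\ldots,n_b)\ne\mathcal{S}(1,1)$ one has $\alpha-2\beta\ne0$, and one defines $$\lambda=\frac{\beta}{\alpha-2\beta},\qquad \mathcal{L}=\frac{1}{\alpha-2\beta}\widehat{\mathcal{L}},$$ and $\eta$ is the $n$-dimensional column vector with entries $\eta(u)=\frac{\alpha-3\beta}{\alpha-2\beta}$ for $u\in V_0$ and $\eta(u)=\frac{\alpha_{\widehat{n_i}}}{\alpha-2\beta}$ for $u\in V_i$, $1\le i\le b$. *)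

(* Defs.v *)
From HB Require Import structures.
From mathcomp Require Import all_boot all_order all_algebra.

Set Implicit Arguments.
Unset Strict Implicit.
Unset Printing Implicit Defensive.

Import GRing.Theory.
Local Open Scope ring_scope.

Section Distance.

Variables (T : finType) (e : rel T).

Definition walk_of_length (x y : T) (k : nat) : bool :=
  [exists p : k.-tuple T, path e x p && (last x p == y)].

(* A shortest walk has fewer than #|T| edges, so searching the lengths        *)
(* 0, ..., #|T|.-1 suffices; the value is #|T| when y is unreachable from x.  *)
Definition gdist (x y : T) : nat := find (walk_of_length x y) (iota 0 #|T|).

End Distance.

Section SquaredDistance.

Variables (R : pzRingType) (T : finType) (e : rel T).
Variables (m : nat) (v : 'I_m -> T).

Definition sqdist_mx : 'M[R]_m :=
  \matrix_(i, j) (gdist e (v i) (v j))%:R ^+ 2.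

End SquaredDistance.

Section Starlike.

Variables (b : nat) (n : 'I_b -> nat).

(* None is the central cut vertex; Some (Tagged _ x) with x : 'I_(n i) is one *)
(* of the n i other vertices of the i-th block.                               *)
Definition star_vertex : finType := option {i : 'I_b & 'I_(n i)}.

Definition star_block (i : 'I_b) : {set star_vertex} :=
  [set u : star_vertex | if u is Some x then tag x == i else true].

Definition star_adj : rel star_vertex :=
  [rel u v | (u != v)
             && [exists i, (u \in star_block i) && (v \in star_block i)]].

Lemma star_adj_sym : symmetric star_adj.
Proof.
move=> u v; rewrite /star_adj /= eq_sym; congr (_ && _).
by apply: eq_existsb => i; rewrite andbC.
Qed.

Lemma star_adj_irr : irreflexive star_adj.
Proof. by move=> u; rewrite /star_adj /= eqxx. Qed.

Lemma card_star_vertex : #|star_vertex| = (\sum_(i < b) n i).+1.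
Proof.
rewrite card_option card_tagged sumnE big_map big_enum /=.
by congr _.+1; apply: eq_bigr => i _; rewrite card_ord.
Qed.

Variable R : fieldType.

Definition alpha : R := \prod_(k < b) (3 * (n k)%:R + 1).

Definition alpha_hat (i : 'I_b) : R :=
  \prod_(k < b | k != i) (3 * (n k)%:R + 1).

Definition alpha_hat2 (i j : 'I_b) : R :=
  \prod_(k < b | (k != i) && (k != j)) (3 * (n k)%:R + 1).

Definition beta : R := \sum_(k < b) (n k)%:R * alpha_hat k.

Definition beta_hat (i : 'I_b) : R :=
  \sum_(k < b | k != i) (n k)%:R * alpha_hat2 i k.

Definition lambda : R := beta / (alpha - 2 * beta).

Definition Lhat_entry (u w : star_vertex) : R :=
  match u, w with
  | None, None => beta
  | None, Some y => - alpha_hat (tag y)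
  | Some x, None => - alpha_hat (tag x)
  | Some x, Some y =>
      if x == y then
        (6 * beta_hat (tag x) - alpha_hat (tag x)) + (alpha - 2 * beta)
      else if tag x == tag y then 6 * beta_hat (tag x) - alpha_hat (tag x)
      else 2 * alpha_hat2 (tag x) (tag y)
  end.

Definition eta_entry (u : star_vertex) : R :=
  match u with
  | None => (alpha - 3 * beta) / (alpha - 2 * beta)
  | Some x => alpha_hat (tag x) / (alpha - 2 * beta)
  end.

Variables (m : nat) (v : 'I_m -> star_vertex).

Definition Lhat_mx : 'M[R]_m := \matrix_(i, j) Lhat_entry (v i) (v j).

Definition L_mx : 'M[R]_m := (alpha - 2 * beta)^-1 *: Lhat_mx.

Definition eta_vec : 'cV[R]_m := \col_i eta_entry (v i).

End Starlike.

(* Main.v *)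
Require Import Defs.
From HB Require Import structures.
From mathcomp Require Import all_boot all_order all_algebra.
From mathcomp Require Import ring lra.

Set Implicit Arguments.
Unset Strict Implicit.
Unset Printing Implicit Defensive.

Import Order.TTheory GRing.Theory Num.Theory.
Local Open Scope ring_scope.

(** The proof verifies Delta X = I for the proposed inverse X, and rests on two
    identities, in which 1 is the all-ones column and I the identity matrix:
      Delta eta = lambda 1    and    Delta L + I = 1 eta^T.
    They give Delta X = (I - 1 eta^T) + lambda^-1 (lambda 1) eta^T = I.

    All the products alpha, beta, ... become transparent after division by
    alpha.  Put w_i = 1 / (3 n_i + 1) and s = \sum_i n_i w_i; then beta / alpha
    = s, lambda = s / (1 - 2 s), and the relation 3 n_i w_i = 1 - w_i turns the
    leaf-leaf entries of L into a rank-one matrix, a block-diagonal matrix and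
    the identity ([L_leaf_leaf]):
      L(x, z) = 2 w_x w_z / (1 - 2 s) - 3 w_z [same block] + [x = z].
    On the other side, distances between leaves are 0, 1 or 2, so that Delta
    has the same shape: its leaf-leaf entries are 4 - 3 [same block] - [x = z].
    The two identities ([sqd_eta], [sqd_L]) therefore reduce to evaluating sums
    of weights over all leaves and over one block.

    The divisions are legitimate because
    4 s = b + \sum_i (n_i - 1) w_i ([four_weight_sum]), which exceeds 2 unless
    b = 2 and n_1 = n_2 = 1; so 1 - 2 s < 0 and s > 0. *)

(** * Distances in a starlike block graph *)

Section ShortDistances.

Variables (T : finType) (e : rel T).

Lemma gdist_eq (x y : T) k :
    (k < #|T|)%N -> walk_of_length e x y k ->
    (forall j, (j < k)%N -> ~~ walk_of_length e x y j) ->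
  gdist e x y = k.
Proof.
move=> ltk wk shorter; rewrite /gdist.
set a := walk_of_length e x y.
have hasa : has a (iota 0 #|T|).
  by apply/hasP; exists k => //; rewrite mem_iota add0n.
have := nth_find 0 hasa; have := before_find 0 (a := a) (s := iota 0 #|T|).
have := hasa; rewrite has_find size_iota => ltf.
rewrite nth_iota // add0n => bf af.
case: (ltngtP (find a (iota 0 #|T|)) k) => // [ltfk | ltkf].
  by move: (shorter _ ltfk); rewrite -/(a _) af.
by move: (bf _ ltkf); rewrite nth_iota // add0n /a wk.
Qed.

Lemma walk0 (x y : T) : walk_of_length e x y 0 = (x == y).
Proof.
apply/existsP/idP => [[p]|xy]; first by rewrite (tuple0 p).
by exists [tuple].
Qed.

Lemma walk1 (x y : T) : walk_of_length e x y 1 = e x y.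
Proof.
apply/existsP/idP => [[p]|exy].
  case/tupleP: p => z p; rewrite (tuple0 p) /= andbT.
  by case/andP=> exz /eqP <-.
by exists [tuple y]; rewrite /= exy eqxx.
Qed.

Lemma gdist_refl (x : T) : gdist e x x = 0%N.
Proof.
apply: gdist_eq => //; last by rewrite walk0.
by apply/card_gt0P; exists x.
Qed.

Lemma gdist_edge (x y : T) : x != y -> e x y -> gdist e x y = 1%N.
Proof.
move=> xy exy; apply: gdist_eq.
- have := max_card [in [:: x; y]].
  suff -> : #|[:: x; y]| = 2 by [].
  by apply/card_uniqP; rewrite /= inE xy.
- by rewrite walk1.
- by case=> // _; rewrite walk0.
Qed.

(** The search for a shortest walk only visits lengths below [#|T|]; here length
    2 is visited because [x], [z] and [y] are three distinct vertices. *)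
Lemma gdist_common_neighbour (x z y : T) :
  x != y -> ~~ e x y -> e x z -> e z y -> gdist e x y = 2%N.
Proof.
move=> xy nexy exz ezy.
have xz : x != z by apply: contraNneq nexy => ->.
have zy : z != y by apply: contraNneq nexy => <-.
apply: gdist_eq.
- have := max_card [in [:: x; z; y]].
  suff -> : #|[:: x; z; y]| = 3 by [].
  by apply/card_uniqP; rewrite /= !inE (negPf xy) (negPf xz) (negPf zy).
- by apply/existsP; exists [tuple z; y]; rewrite /= exz ezy eqxx.
- by case=> [|[|j]] // _; rewrite ?walk0 ?walk1.
Qed.

End ShortDistances.

Section StarDistances.

Variables (b : nat) (n : 'I_b -> nat).

Local Notation leaf := {i : 'I_b & 'I_(n i)}.
Local Notation d := (gdist (star_adj (n := n))).

Lemma star_adj_center (x : leaf) : star_adj None (Some x).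
Proof.
by apply/andP; split=> //; apply/existsP; exists (tag x); rewrite !inE eqxx.
Qed.

Lemma star_adj_leaf (x y : leaf) :
  star_adj (Some x) (Some y) = (x != y) && (tag x == tag y).
Proof.
rewrite /star_adj /=; congr (_ && _).
apply/existsP/eqP => [[i]|xy]; first by rewrite !inE => /andP[/eqP -> /eqP].
by exists (tag x); rewrite !inE xy eqxx.
Qed.

Lemma gdist_center_leaf (x : leaf) : d None (Some x) = 1%N.
Proof. by apply: gdist_edge => //; apply: star_adj_center. Qed.

Lemma gdist_leaf_center (x : leaf) : d (Some x) None = 1%N.
Proof. by apply: gdist_edge => //; rewrite star_adj_sym star_adj_center. Qed.

Lemma gdist_leaf_leaf (x y : leaf) :
  d (Some x) (Some y) =
    if x == y then 0 else if tag x == tag y then 1 else 2.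
Proof.
case: eqVneq => [-> | xy]; first exact: gdist_refl.
case: ifP => txy; first by apply: gdist_edge; rewrite // star_adj_leaf xy.
apply: (@gdist_common_neighbour _ _ _ None) => //.
- by rewrite star_adj_leaf txy andbF.
- by rewrite star_adj_sym star_adj_center.
- exact: star_adj_center.
Qed.

End StarDistances.

(** * The action of the squared distance matrix *)

Section SquaredDistanceAction.

Variables (R : realFieldType) (b : nat) (n : 'I_b -> nat).

Local Notation leaf := {i : 'I_b & 'I_(n i)}.

Definition sqd (u w : star_vertex n) : R :=
  (gdist (star_adj (n := n)) u w)%:R ^+ 2.

Lemma sum_star_vertex (F : star_vertex n -> R) :
  \sum_u F u = F None + \sum_(x : leaf) F (Some x).
Proof.
rewrite (bigD1 None) //=; congr (_ + _).
rewrite (reindex_omap Some id); first by apply: eq_bigl => x /=; rewrite eqxx.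
by case.
Qed.

Lemma sum_block_const (i : 'I_b) (c : R) :
  \sum_(x : leaf | tag x == i) c = (n i)%:R * c.
Proof.
transitivity (\sum_(j < b | j == i) \sum_(k < n j) c).
  rewrite (sig_big_dep _ (fun=> xpredT) (fun _ _ => c)).
  by apply: eq_bigl => x; rewrite andbT.
by rewrite big_pred1_eq sumr_const card_ord mulr_natl.
Qed.

Lemma sum_leaf_tag (g : 'I_b -> R) :
  \sum_(x : leaf) g (tag x) = \sum_(i < b) (n i)%:R * g i.
Proof.
rewrite (partition_big (fun x => tag x) xpredT) //=.
apply: eq_bigr => i _; rewrite -sum_block_const.
by apply: eq_bigr => x /eqP ->.
Qed.

Lemma sum_leaf_delta (P : pred leaf) (z : leaf) :
  \sum_(x | P x) (x == z)%:R = (P z)%:R :> R.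
Proof.
rewrite big_mkcond (bigD1 z) //= eqxx big1 ?addr0; first by case: (P z).
by move=> x /negPf ->; case: ifP.
Qed.

Lemma sum_sqd_center (f : star_vertex n -> R) :
  \sum_u sqd None u * f u = \sum_(x : leaf) f (Some x).
Proof.
rewrite sum_star_vertex /sqd gdist_refl expr0n /= mul0r add0r.
by apply: eq_bigr => x _; rewrite gdist_center_leaf expr1n mul1r.
Qed.

(** The coefficients come from writing the squared distance between leaves as
    4 - 3 [same block] - [equal], which is 0, 1 or 4. *)
Lemma sum_sqd_leaf (f : star_vertex n -> R) (x : leaf) :
  \sum_u sqd (Some x) u * f u =
    f None + 4 * (\sum_(y : leaf) f (Some y))
    - 3 * (\sum_(y : leaf | tag y == tag x) f (Some y)) - f (Some x).
Proof.
rewrite sum_star_vertex /sqd gdist_leaf_center expr1n mul1r -!addrA.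
congr (_ + _).
rewrite [\sum_(y | tag y == _) _]big_mkcond.
have -> : f (Some x) = \sum_(y : leaf) (y == x)%:R * f (Some y).
  rewrite (bigD1 x) //= eqxx mul1r big1 ?addr0 // => y /negPf ->.
  by rewrite mul0r.
rewrite !mulr_sumr -!sumrN -!big_split /=; apply: eq_bigr => y _.
rewrite gdist_leaf_leaf [y == x]eq_sym [tag y == _]eq_sym.
case: eqVneq => [->|_]; first by rewrite eqxx /=; ring.
by case: (tag x == tag y) => /=; ring.
Qed.

End SquaredDistanceAction.

(** * Normalization by alpha *)

Section Weights.

Variables (R : realFieldType) (b : nat) (n : 'I_b -> nat).

Local Notation leaf := {i : 'I_b & 'I_(n i)}.

Definition weight (i : 'I_b) : R := (3 * (n i)%:R + 1)^-1.

Definition weight_sum : R := \sum_(i < b) (n i)%:R * weight i.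

Local Notation a i := (3 * (n i)%:R + 1 : R).
Local Notation w := weight.
Local Notation s := weight_sum.
Local Notation al := (alpha n R).
Local Notation c := ((1 - 2 * s)^-1).

Lemma block_factor_gt0 i : 0 < a i.
Proof. by have := ler0n R (n i); lra. Qed.

Lemma weight_gt0 i : 0 < w i.
Proof. by rewrite invr_gt0 block_factor_gt0. Qed.

Lemma mul_weight i : a i * w i = 1.
Proof. by rewrite mulfV // lt0r_neq0 // block_factor_gt0. Qed.

Lemma alpha_neq0 : al != 0.
Proof.
by apply/prodf_neq0 => i _; rewrite lt0r_neq0 // block_factor_gt0.
Qed.

Lemma alpha_hatE i : alpha_hat n R i = al * w i.
Proof.
by rewrite /alpha (bigD1 i) //= mulrAC mul_weight mul1r.
Qed.

Lemma alpha_hat2E i j : i != j -> alpha_hat2 n R i j = al * w i * w j.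
Proof.
move=> ij; rewrite -alpha_hatE /alpha_hat (bigD1 j) 1?eq_sym //=.
by rewrite mulrAC mul_weight mul1r.
Qed.

Lemma betaE : beta n R = al * s.
Proof.
rewrite mulr_sumr; apply: eq_bigr => i _.
by rewrite alpha_hatE; ring.
Qed.

Lemma beta_hatE i : beta_hat n R i = al * w i * (s - (n i)%:R * w i).
Proof.
rewrite /weight_sum (bigD1 i) //= addrC addrK mulr_sumr.
apply: eq_bigr => j ji; rewrite alpha_hat2E 1?eq_sym //; ring.
Qed.

Lemma alpha_sub_betaE : al - 2 * beta n R = al * (1 - 2 * s).
Proof. by rewrite betaE; ring. Qed.

Lemma weight_sum_blocks : \sum_(x : leaf) w (tag x) = s.
Proof. exact: sum_leaf_tag. Qed.

Lemma weight_sum_block i :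
  \sum_(x : leaf | tag x == i) w (tag x) = (n i)%:R * w i.
Proof. by rewrite -sum_block_const; apply: eq_bigr => x /eqP ->. Qed.

(** Termwise this says 4 n_i w_i = 1 + (n_i - 1) w_i, that is, (3 n_i + 1) w_i =
    1.  It isolates the excess of s over b / 4, which for n_i >= 1
    vanishes only when all n_i are 1. *)
Lemma four_weight_sum :
  4 * s = b%:R + \sum_(i < b) ((n i)%:R - 1) * w i.
Proof.
have -> : b%:R = \sum_(i < b) 1 :> R by rewrite sumr_const card_ord.
rewrite mulr_sumr -big_split /=; apply: eq_bigr => i _.
by have := mul_weight i; lra.
Qed.

Hypothesis n_ge1 : forall i : 'I_b, (1 <= n i)%N.

Lemma weight_sum_gt_half :
    (2 <= b)%N -> ~ (b = 2%N /\ forall i : 'I_b, n i = 1%N) ->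
  1 < 2 * s.
Proof.
move=> b_ge2 not_S11.
have term_ge0 i : 0 <= ((n i)%:R - 1) * w i.
  by rewrite mulr_ge0 ?subr_ge0 ?ler1n //
             ltW ?weight_gt0.
suff : 2 < 4 * s by lra.
rewrite four_weight_sum.
move: b_ge2; rewrite leq_eqVlt => /orP[/eqP b2 | b_gt2].
- have [i ni] : exists i, n i != 1%N.
    apply/existsP; rewrite -negb_forall; apply/negP => /forallP n1.
    by apply: not_S11; split=> // i; apply/eqP.
  have -> : b%:R = 2 :> R by rewrite -b2.
  rewrite ltrDl (bigD1 i) //=.
  apply: ltr_pwDl; last exact: sumr_ge0.
  rewrite mulr_gt0 ?weight_gt0 // subr_gt0.
  by rewrite ltr1n ltn_neqAle eq_sym ni n_ge1.
- apply: ltr_wpDr; first exact: sumr_ge0.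
  by rewrite ltr_nat.
Qed.

Hypothesis s_gt_half : 1 < 2 * s.

Lemma gap_neq0 : 1 - 2 * s != 0.
Proof. by apply/eqP; move: s_gt_half; lra. Qed.

Lemma lambdaE : lambda n R = s * c.
Proof.
rewrite /lambda alpha_sub_betaE betaE.
by field; rewrite alpha_neq0 gap_neq0.
Qed.

Lemma eta_centerE : eta_entry R (None : star_vertex n) = (1 - 3 * s) * c.
Proof.
rewrite /= alpha_sub_betaE betaE.
by field; rewrite alpha_neq0 gap_neq0.
Qed.

Lemma eta_leafE (x : leaf) : eta_entry R (Some x) = w (tag x) * c.
Proof.
rewrite /= alpha_sub_betaE alpha_hatE.
by field; rewrite alpha_neq0 gap_neq0.
Qed.

(** The entries of [L_mx], indexed by vertices rather than by their positions in
    an enumeration. *)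
Definition L_entry (u z : star_vertex n) : R :=
  (al - 2 * beta n R)^-1 * Lhat_entry R u z.

Lemma L_center_center : L_entry None None = s * c.
Proof.
rewrite /L_entry /= alpha_sub_betaE betaE.
by field; rewrite alpha_neq0 gap_neq0.
Qed.

Lemma L_center_leaf (z : leaf) : L_entry None (Some z) = - (w (tag z) * c).
Proof.
rewrite /L_entry /= alpha_sub_betaE alpha_hatE.
by field; rewrite alpha_neq0 gap_neq0.
Qed.

Lemma L_leaf_center (x : leaf) : L_entry (Some x) None = - (w (tag x) * c).
Proof. exact: L_center_leaf. Qed.

(** The point is the disappearance of beta_hat: with 6 n_i w_i = 2 (1 - w_i), the
    entry 6 beta_hat_i - alpha_hat_i is alpha times 2 w_i^2 - 3 (1 - 2 s) w_i,
    so entries inside a block differ from the pattern 2 w_i w_j valid between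
    blocks only by a correction free of s after division by 1 - 2 s. *)
Lemma L_leaf_leaf (x z : leaf) :
  L_entry (Some x) (Some z) =
    2 * w (tag z) * c * w (tag x) - 3 * w (tag z) * (tag x == tag z)%:R
    + (x == z)%:R.
Proof.
rewrite /L_entry /= alpha_sub_betaE beta_hatE alpha_hatE.
have same_block i : 6 * (al * w i * (s - (n i)%:R * w i)) - al * w i =
    al * (1 - 2 * s) * (2 * w i * c * w i - 3 * w i).
  (* the summand 6 n_i w_i is regrouped so that a_i w_i = 1 applies *)
  transitivity (al * (w i * (6 * s - 1 - 2 * (a i * w i - w i)))).
    by ring.
  rewrite mul_weight; field; exact: gap_neq0.
have nz : al * (1 - 2 * s) != 0 by rewrite mulf_neq0 ?alpha_neq0 ?gap_neq0.
case: eqVneq => [<- | xz].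
  rewrite eqxx same_block; apply: (mulfI nz); rewrite mulVKf //=; ring.
case: eqVneq => [<- | txz].
  rewrite same_block; apply: (mulfI nz); rewrite mulVKf //=; ring.
rewrite alpha_hat2E //; apply: (mulfI nz); rewrite mulVKf //=.
by field; rewrite gap_neq0.
Qed.

(** * The two identities *)

(** Delta eta = lambda 1.  Write c = 1 / (1 - 2 s).  Every row sees the total
    c s of eta over the leaves; at a leaf of block i, the deficit caused by its
    own block and by itself is (3 n_i + 1) w_i c = c, the same for all blocks,
    and the central entry of eta compensates it. *)
Lemma sqd_eta (u : star_vertex n) :
  \sum_t sqd R u t * eta_entry R t = lambda n R.
Proof.
have total : \sum_(x : leaf) eta_entry R (Some x) = s * c.
  by under eq_bigr do rewrite eta_leafE; rewrite -mulr_suml weight_sum_blocks.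
have block i : \sum_(x : leaf | tag x == i) eta_entry R (Some x) =
    (n i)%:R * w i * c.
  by under eq_bigr do rewrite eta_leafE; rewrite -mulr_suml weight_sum_block.
rewrite lambdaE; case: u => [x|]; last by rewrite sum_sqd_center.
rewrite sum_sqd_leaf total block eta_centerE eta_leafE.
transitivity ((1 - 3 * s) * c + 4 * (s * c) - a (tag x) * w (tag x) * c).
  by ring.
by rewrite mul_weight; ring.
Qed.

(** Delta L = 1 eta^T - I.  A column of L is, up to its own block, a multiple of
    the weights, so the cancellation (3 n_i + 1) w_i = 1 again removes any
    dependence on the row apart from the identity matrix. *)
Lemma sqd_L (u z : star_vertex n) :
  \sum_t sqd R u t * L_entry t z = eta_entry R z - (u == z)%:R.
Proof.
case: z => [z|]; last first.
- have total : \sum_(x : leaf) L_entry (Some x) None = - (s * c).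
    under eq_bigr do rewrite L_leaf_center.
    by rewrite sumrN -mulr_suml weight_sum_blocks.
  have block i : \sum_(x : leaf | tag x == i) L_entry (Some x) None =
      - ((n i)%:R * w i * c).
    under eq_bigr do rewrite L_leaf_center.
    by rewrite sumrN -mulr_suml weight_sum_block.
  rewrite eta_centerE; case: u => [x|].
    rewrite sum_sqd_leaf total block L_center_center L_leaf_center /=.
    transitivity (s * c - 4 * (s * c) + a (tag x) * w (tag x) * c).
      by ring.
    by rewrite mul_weight; ring.
  by rewrite sum_sqd_center total eqxx /=; field; exact: gap_neq0.
have total : \sum_(x : leaf) L_entry (Some x) (Some z) = w (tag z) * c.
  under eq_bigr do rewrite L_leaf_leaf.
  rewrite big_split sumrB -!mulr_sumr weight_sum_blocks sum_leaf_delta /=.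
  have -> : \sum_(x : leaf) (tag x == tag z)%:R = (n (tag z))%:R :> R.
    rewrite (sum_leaf_tag _ (fun i => (i == tag z)%:R)) (bigD1 (tag z)) //=.
    by rewrite eqxx mulr1 big1 ?addr0 // => i /negPf ->; rewrite mulr0.
  transitivity (2 * w (tag z) * c * s - a (tag z) * w (tag z) + w (tag z) + 1).
    by ring.
  by rewrite mul_weight; field; exact: gap_neq0.
have block i : \sum_(x : leaf | tag x == i) L_entry (Some x) (Some z) =
    2 * w (tag z) * c * ((n i)%:R * w i) + w (tag z) * (i == tag z)%:R.
  under eq_bigr do rewrite L_leaf_leaf.
  rewrite big_split sumrB -!mulr_sumr weight_sum_block sum_leaf_delta /=.
  have -> : \sum_(x : leaf | tag x == i) (tag x == tag z)%:R =
      (n i)%:R * (i == tag z)%:R :> R.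
    by rewrite -sum_block_const; apply: eq_bigr => x /eqP ->.
  rewrite [tag z == i]eq_sym; case: eqVneq => [-> | _] /=; last by ring.
  transitivity (2 * w (tag z) * c * ((n (tag z))%:R * w (tag z))
                - a (tag z) * w (tag z) + w (tag z) + 1).
    by ring.
  by rewrite mul_weight; ring.
rewrite eta_leafE; case: u => [x|]; last first.
  by rewrite sum_sqd_center total /= subr0.
rewrite sum_sqd_leaf total block L_center_leaf L_leaf_leaf.
have -> : (Some x == Some z) = (x == z) by [].
transitivity (3 * (w (tag z) * c) - 2 * w (tag z) * c * (a (tag x) * w (tag x))
              - (x == z)%:R).
  by ring.
by rewrite mul_weight; ring.
Qed.

End Weights.

(** * The inverse *)

Theorem theorem3p4 (R : realFieldType) (b : nat) (n : 'I_b -> nat)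
    (b_ge2 : (2 <= b)%N)
    (n_ge1 : forall i : 'I_b, (1 <= n i)%N)
    (not_S11 : ~ (b = 2%N /\ forall i : 'I_b, n i = 1%N))
    (v : 'I_(\sum_(i < b) n i).+1 -> star_vertex n)
    (v_bij : bijective v) :
  sqdist_mx R (@star_adj b n) v \in unitmx /\
  invmx (sqdist_mx R (@star_adj b n) v) =
    - L_mx R v + (lambda n R)^-1 *: (eta_vec R v *m (eta_vec R v)^T).
Proof.
have s_gt := weight_sum_gt_half R n_ge1 b_ge2 not_S11.
have lambda_neq0 : lambda n R != 0.
  rewrite lambdaE // mulf_neq0 ?invr_eq0 ?gap_neq0 //.
  by apply/eqP; move: s_gt; lra.
set D := sqdist_mx _ _ _; set E := eta_vec R v.
have sum_v (F : star_vertex n -> R) : \sum_k F (v k) = \sum_u F u.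
  by rewrite [RHS](reindex v) //; apply: onW_bij.
have D_eta : D *m E = const_mx (lambda n R).
  apply/matrixP => i j; rewrite !mxE -(sqd_eta s_gt (v i)) -sum_v.
  by apply: eq_bigr => k _; rewrite !mxE.
have D_L : D *m L_mx R v = const_mx 1 *m E^T - 1%:M.
  apply/matrixP => i j; rewrite !mxE big_ord1 !mxE mul1r.
  rewrite -(inj_eq (bij_inj v_bij)) -(sqd_L s_gt) -sum_v.
  by apply: eq_bigr => k _; rewrite !mxE.
have D_X : D *m (- L_mx R v + (lambda n R)^-1 *: (E *m E^T)) = 1%:M.
  rewrite mulmxDr mulmxN D_L -scalemxAr mulmxA D_eta scalemxAl.
  have -> : (lambda n R)^-1 *: const_mx (lambda n R) =
      const_mx 1 :> 'cV[R]_(\sum_(i < b) n i).+1.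
    by apply/matrixP => i j; rewrite !mxE mulVf.
  by rewrite opprB subrK.
have [D_unit _] := mulmx1_unit D_X.
by split=> //; rewrite -[RHS](mulKmx D_unit) D_X mulmx1.
Qed.
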